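(* Let $\overrightarrow{G}$ be a digraph with no loops or parallel arcs, with vertex set $V(\overrightarrow{G})=\{v_1,\dots,v_n\}$ and arc set $E(\overrightarrow{G})=\{\overrightarrow{e_1},\dots,\overrightarrow{e_m}\}$, and let $1\le k\le n$. For $M\in\{A,L,Q\}$ let $\Phi^M_k(\overrightarrow{G},x)=d_{(k,1^{n-k})}(xI_n-M(\overrightarrow{G}))$ and let $\Phi'^M_k(\overrightarrow{G},x)$ denote its derivative with respect to $x$. Then $$(m-n)\Phi^M_k(\overrightarrow{G},x)+x\,\Phi'^M_k(\overrightarrow{G},x)=\sum_{\overrightarrow{e}\in E(\overrightarrow{G})}\Phi^M_k(\overrightarrow{G}-\overrightarrow{e},x).$$
   Context: For a partition $\lambda$ of $n$ with irreducible character $\chi_\lambda$ of the symmetric group $S_n$, the immanant of an $n\times n$ matrix $B=(b_{ij})$ is $d_\lambda(B)=\sum_{\sigma\in S_n}\chi_\lambda(\sigma)\prod_{i=1}^n b_{i\sigma(i)}$; for the hook partition $\lambda=(k,1^{n-k})$ this is the hook immanant. For a digraph $\overrightarrow{G}$: $A(\overrightarrow{G})=(a_{ij})$ with $a_{ij}=1$ if $(v_i,v_j)$ is an arc and $0$ otherwise; $D(\overrightarrow{G})=\mathrm{diag}(d^-(v_1),\dots,d^-(v_n))$ where $d^-(v_i)$ is the in-degree of $v_i$; $L(\overrightarrow{G})=D(\overrightarrow{G})-A(\overrightarrow{G})$ and $Q(\overrightarrow{G})=D(\overrightarrow{G})+A(\overrightarrow{G})$. $\overrightarrow{G}-\overrightarrow{e}$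 is the digraph obtained by deleting the arc $\overrightarrow{e}$ and keeping all vertices and other arcs (its matrices $A,D,L,Q$ are computed for the new digraph). *)

(* Defs.v *)
From HB Require Import structures.
From mathcomp Require Import all_boot all_order all_algebra all_fingroup.
From mathcomp Require Import all_solvable all_field all_character.
Set Implicit Arguments.
Unset Strict Implicit.
Unset Printing Implicit Defensive.
Import Order.TTheory GRing.Theory Num.Theory.
Local Open Scope ring_scope.

Section SymmetricGroupCharacters.

(* lam stands for a partition of n: a nonincreasing sequence of positive integers
   of sum n. Other sequences give meaningless values. Its Young diagram is
   filled row by row with 0, ..., n - 1, so that entry i lies in row
   [reshape_index lam i] and column [reshape_offset lam i]. *)
Variables (n : nat) (lam : seq nat).

Definition row_stab : {set 'S_n} :=
  [set s : 'S_n | [forall i, reshape_index lam (s i) == reshape_index lam i]].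

Definition col_stab : {set 'S_n} :=
  [set s : 'S_n | [forall i, reshape_offset lam (s i) == reshape_offset lam i]].

Let aG := regular_repr algC [set: 'S_n]%G.

(* The product of 'S_n is (s * t) i = t (s i), the reverse of composition of
   functions. Hence this product is the classical symmetrizer c = a b (a the sum
   over the row group, b the signed sum over the column group), and the right
   ideal c C[S_n] used below is the classical left ideal C[S_n] c. *)
Definition young_symmetrizer : 'M[algC]_#|[set: 'S_n]%G| :=
  (\sum_(s in col_stab) (-1) ^+ s *: aG s) *m (\sum_(s in row_stab) aG s).

Definition specht_mx : 'M[algC]_#|[set: 'S_n]%G| :=
  cyclic_mx aG (gring_row young_symmetrizer).

Definition specht_repr :=
  submod_repr (cyclic_mx_module aG (gring_row young_symmetrizer)
               : mxmodule aG specht_mx).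

Definition sym_char : 'CF([set: 'S_n]) := cfRepr specht_repr.

End SymmetricGroupCharacters.

Definition immanant (R : comAlgType algC) (n : nat) (lam : seq nat)
    (B : 'M[R]_n) : R :=
  \sum_(s : 'S_n) sym_char n lam s *: \prod_i B i (s i).

(* The partition (k, 1^(n-k)), for 1 <= k <= n. *)
Definition hook (n k : nat) : seq nat := k :: nseq (n - k) 1%N.

(* A digraph on the vertices 'I_n without parallel arcs is its set of arcs, the
   pair (i, j) being the arc from i to j; pairs of opposite arcs are allowed. *)
Definition digraph (n : nat) := {set 'I_n * 'I_n}.

Section DigraphMatrices.
Variables (n : nat) (E : digraph n).

Definition loopless := [forall i, (i, i) \notin E].

Definition indegree (i : 'I_n) : nat := #|[set j | (j, i) \in E]|.

Definition adj_mx : 'M[algC]_n := \matrix_(i, j) ((i, j) \in E)%:R.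

Definition indegree_mx : 'M[algC]_n := diag_mx (\row_i (indegree i)%:R).

Definition laplacian_mx : 'M[algC]_n := indegree_mx - adj_mx.

Definition signless_laplacian_mx : 'M[algC]_n := indegree_mx + adj_mx.

End DigraphMatrices.

Definition hook_poly (n k : nat) (M : 'M[algC]_n) : {poly algC} :=
  immanant (hook n k) (char_poly_mx M).

(* Main.v *)
Require Import Defs.
From HB Require Import structures.
From mathcomp Require Import all_boot all_order all_algebra all_fingroup.
From mathcomp Require Import all_solvable all_field all_character.
Set Implicit Arguments.
Unset Strict Implicit.
Unset Printing Implicit Defensive.
Import Order.TTheory GRing.Theory Num.Theory.
Local Open Scope ring_scope.

(** The identity holds for each permutation [s] separately. Each of the three
    matrices is a sum over the arcs of a matrix supported on the column of the
    head of the arc. Hence deleting [e] changes only the factor of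
    [\prod_i (xI - M) i (s i)] with [s i] the head of [e], and it does so
    additively. Summing the losses over all arcs replaces each factor in turn
    by its non-[x] part, which gives [n] times the product minus [x] times its
    derivative. *)

Lemma deriv_prod (R : comNzRingType) (I : finType) (F : I -> {poly R}) :
  (\prod_i F i)^`() = \sum_i (F i)^`() * \prod_(j | j != i) F j.
Proof.
(* The induction runs over duplicate-free sequences, where the condition [j != i] drops exactly one
   factor. *)
have derivP (r : seq I) : uniq r ->
    (\prod_(i <- r) F i)^`()
      = \sum_(i <- r) (F i)^`() * \prod_(j <- r | j != i) F j.
  elim: r => [|a r IHr] /=; first by rewrite !big_nil derivC.
  case/andP=> a_r /IHr {}IHr; rewrite !big_cons derivM IHr eqxx /=.
  have neq_a i : i \in r -> a != i by apply: contraTneq => <-.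
  congr (_ * _ + _).
    by rewrite big_seq [RHS]big_seq_cond; apply: eq_bigl => i;
       case: (boolP (i \in r)) => // /neq_a; rewrite eq_sym.
  rewrite big_distrr; apply: eq_big_seq => i /neq_a ai /=.
  by rewrite big_cons ai mulrCA.
exact/derivP/index_enum_uniq.
Qed.

Section ArcSum.

Variables (R : comNzRingType) (n : nat) (W : 'I_n * 'I_n -> 'M[R]_n).
Hypothesis W_head : forall e i j, j != e.2 -> W e i j = 0.

Let B (E : digraph n) := char_poly_mx (\sum_(e in E) W e).

Lemma char_poly_mx_delete_arc (E : digraph n) e i j : e \in E ->
  B (E :\ e) i j = B E i j + (W e i j)%:P.
Proof.
move=> eE; rewrite /B (big_setD1 e eE) /= !mxE polyCD opprD addrA.
by rewrite addrAC subrK.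
Qed.

(** At most one term of the sum over [i] is nonzero. Keeping all of them gives an index set
    independent of [e], so that this sum can later be exchanged with the sum over arcs. *)
Lemma prod_delete_arc (E : digraph n) (s : 'S_n) e : e \in E ->
  \prod_i B (E :\ e) i (s i)
    = \prod_i B E i (s i)
      + \sum_i (W e i (s i))%:P * \prod_(j | j != i) B E j (s j).
Proof.
(* [i0] is the row where [s] selects the column of the head of [e]; every other factor is
   unchanged. *)
move=> eE; pose i0 := (s^-1)%g e.2.
have W0 i : i != i0 -> W e i (s i) = 0.
  by move=> ne; rewrite W_head // -(inj_eq (@perm_inj _ s^-1)) permK.
rewrite (bigD1 i0) //= [X in _ = X + _](bigD1 i0) //= [X in _ = _ + X](bigD1 i0) //=.
rewrite [X in _ = _ + (_ + X)]big1 ?addr0; last first.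
  by move=> i ne; rewrite W0 // mul0r.
rewrite char_poly_mx_delete_arc // -mulrDl; congr (_ * _).
apply: eq_bigr => i ne.
by rewrite char_poly_mx_delete_arc // W0 // addr0.
Qed.

(** An entry has degree at most one in ['X], so ['X] times its derivative is its ['X] part;
    subtracting the entry leaves the entry of the matrix itself. *)
Lemma char_poly_mx_euler (E : digraph n) i j :
  \sum_(e in E) (W e i j)%:P = 'X * (B E i j)^`() - B E i j.
Proof.
rewrite -rmorph_sum -summxE /B !mxE derivB derivC subr0 derivMn derivX.
by rewrite mulrnAr mulr1 subKr.
Qed.

Lemma sum_prod_delete_arc (E : digraph n) (s : 'S_n) :
  let P := \prod_i B E i (s i) in
  \sum_(e in E) \prod_i B (E :\ e) i (s i)
    = (#|E|%:R - n%:R) * P + 'X * P^`().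
Proof.
move=> P; rewrite (eq_bigr _ (fun e => @prod_delete_arc E s e)).
rewrite big_split /= sumr_const exchange_big /= -/P.
under eq_bigr => i _ do rewrite -mulr_suml char_poly_mx_euler mulrBl -mulrA.
rewrite sumrB -mulr_sumr -deriv_prod -/P.
(* Each of the [n] terms is [P] with the factor at [i] split off. *)
have -> : \sum_i B E i (s i) * (\prod_(j | j != i) B E j (s j)) = n%:R * P.
  under eq_bigr => i _.
    rewrite -(bigD1 (P := xpredT) i) //; over.
  by rewrite sumr_const card_ord mulr_natl.
by rewrite mulrBl !mulr_natl -addrA [- _ + _]addrC.
Qed.

End ArcSum.

(** The immanant combines the products over [s] linearly, with character values that do not depend
    on the digraph, so the identity for each [s] carries over. *)
Lemma hook_poly_delete_arc (n k : nat) (W : 'I_n * 'I_n -> 'M[algC]_n)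
    (M : digraph n -> 'M[algC]_n) (E : digraph n) :
    (forall e i j, j != e.2 -> W e i j = 0) ->
    (forall F, M F = \sum_(e in F) W e) ->
  (#|E|%:R - n%:R) * hook_poly k (M E) + 'X * (hook_poly k (M E))^`()
    = \sum_(e in E) hook_poly k (M (E :\ e)).
Proof.
move=> W_head M_sum; rewrite /hook_poly /immanant exchange_big /=.
rewrite raddf_sum !mulr_sumr -big_split; apply: eq_bigr => s _ /=.
under [RHS]eq_bigr => e _ do rewrite M_sum.
by rewrite derivZ -!scalerAr -scalerDr -scaler_sumr sum_prod_delete_arc // M_sum.
Qed.

Lemma adj_mx_sum (n : nat) (E : digraph n) :
  adj_mx E = \sum_(e in E) delta_mx e.1 e.2.
Proof.
apply/matrixP=> i j; rewrite summxE mxE.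
under eq_bigr => e _ do rewrite mxE -xpair_eqE -surjective_pairing eq_sym.
have [ijE | ijNE] := boolP ((i, j) \in E).
  rewrite (bigD1 (i, j)) //= eqxx big1 ?addr0 // => e /andP[_ /negPf ->] //.
by rewrite big1 // => e eE; case: eqP eE ijNE => // -> ->.
Qed.

Lemma indegree_mx_sum (n : nat) (E : digraph n) :
  indegree_mx E = \sum_(e in E) delta_mx e.2 e.2.
Proof.
apply/matrixP=> i j; rewrite summxE !mxE.
under eq_bigr => e _ do rewrite mxE.
have [<- | ne_ij] := eqVneq i j; last first.
  rewrite big1 // => e _; case: eqP => //= <-.
  by rewrite eq_sym (negPf ne_ij).
under eq_bigr => e _ do rewrite andbb.
rewrite -natr_sum -big_mkcondr /= sum1_card mulr1n /indegree; congr _%:R.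
(* The in-degree counts tails, the sum counts arcs; pairing a tail with the head [i] matches
   them. *)
have pair_inj : injective (fun x : 'I_n => (x, i)) by move=> x y [].
rewrite -(card_imset _ pair_inj); apply: eq_card => -[a b].
rewrite [RHS]unfold_in /=; apply/imsetP/andP => [[x] | [abE /eqP eq_ib]].
  by rewrite inE => xE [-> ->].
by exists a; rewrite ?inE eq_ib.
Qed.

Theorem theorem1 (n k : nat) (E : digraph n) (M : digraph n -> 'M[algC]_n)
  (loopless_E : loopless E) (k_gt0 : (1 <= k)%N) (k_le_n : (k <= n)%N)
  (M_kind : [\/ M = @adj_mx n, M = @laplacian_mx n
              | M = @signless_laplacian_mx n]) :
  (#|E|%:R - n%:R) * hook_poly k (M E) + 'X * (hook_poly k (M E))^`()
    = \sum_(e in E) hook_poly k (M (E :\ e)).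
Proof.
have delta_head (e : 'I_n * 'I_n) i i' j :
    j != e.2 -> delta_mx i e.2 i' j = 0 :> algC.
  by move=> /negPf ne; rewrite mxE ne andbF.
case: M_kind => ->.
- by apply: hook_poly_delete_arc (@adj_mx_sum n) => e i j /delta_head.
(* Both the diagonal and the adjacency contribution of an arc lie in the column of its head. *)
- pose W (e : 'I_n * 'I_n) : 'M[algC]_n := delta_mx e.2 e.2 - delta_mx e.1 e.2.
  apply: (@hook_poly_delete_arc n k W) => [e i j ne | F].
    by rewrite mxE [X in _ + X]mxE !delta_head // subr0.
  by rewrite /laplacian_mx adj_mx_sum indegree_mx_sum -sumrB.
- pose W (e : 'I_n * 'I_n) : 'M[algC]_n := delta_mx e.2 e.2 + delta_mx e.1 e.2.
  apply: (@hook_poly_delete_arc n k W) => [e i j ne | F].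
    by rewrite mxE !delta_head // addr0.
  by rewrite /signless_laplacian_mx adj_mx_sum indegree_mx_sum -big_split.
Qed.
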